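(* Let $g_1,\dots,g_m\in\mathbb{R}[\mathbf{x}]$ be polynomials in $\mathbf{x}=(x_1,\dots,x_d)$, let $g_0=1$ and $g_{m+1}(\mathbf{x})=1-\|\mathbf{x}\|^2$, and let $\mathbf{\Omega}=\{\mathbf{x}\in\mathbb{R}^d: g_j(\mathbf{x})\ge 0,\ j=1,\dots,m+1\}$ (which is therefore compact), assumed nonempty. Assume that $g_j$ is SOS-concave for every $j\in\{1,\dots,m+1\}$. Let $f\in\mathbb{R}[\mathbf{x}]$ (not necessarily convex on $\mathbb{R}^d$) be Hessian-$Q$-module convex over $\mathbf{\Omega}$, that is, $$\nabla^2 f(\mathbf{x})=\sum_{j=0}^{m+1}\mathbf{L}_j(\mathbf{x})\,\mathbf{L}_j(\mathbf{x})^\top g_j(\mathbf{x}),\qquad\forall\,\mathbf{x}\in\mathbb{R}^d,$$ for some matrix polynomials $\mathbf{L}_j\in\mathbb{R}[\mathbf{x}]^{d\times r_j}$, $r_j\in\mathbb{N}$. Put $a_j=\max_{k,l}\deg(\mathbf{L}_j(k,l))$ for $j\in\{0,\dots,m+1\}$, where $\mathbf{L}_j(k,l)$ is the $(k,l)$ entry of $\mathbf{L}_j$, and let $d_j=\lceil \deg(g_j)/2\rceil$, $d_f=\lceil\deg(f)/2\rceil$. Let $f^*=\min_{\mathbf{x}\in\mathbf{\Omega}}f(\mathbf{x})$, and for $n\ge n_{\min}:=\max\{\max_{j\in\{0,\dots,m+1\}}d_j,\ d_f\}$ consider the semidefinite relaxation $$\rho_n=\min_{\boldsymbol{\phi}\in\mathbb{R}^{\mathbb{N}^d_{2n}}}\big\{\phi(f):\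 \phi(1)=1,\ \mathbf{M}_{n-d_j}(g_j\cdot\boldsymbol{\phi})\succeq\mathbf{0},\ j\in\{0,\dots,m+1\}\big\}.$$ Then: (1) For every $n\ge n_{\min}$, this relaxation has an optimal solution $\boldsymbol{\phi}^{(n)}$. (2) If in addition $$n\ \ge\ 1+\max\Big\{\max_{j\in\{1,\dots,m+1\}}(a_j+d_j),\ a_0\Big\},$$ then for every optimal solution $\boldsymbol{\phi}^{(n)}$, with Riesz functional $\phi^{(n)}$, the point $\phi^{(n)}(\mathbf{x}):=(\phi^{(n)}(x_1),\dots,\phi^{(n)}(x_d))$ belongs to $\mathbf{\Omega}$ and $$\rho_n=f^*=f(\phi^{(n)}(\mathbf{x})),$$ i.e. $\phi^{(n)}(\mathbf{x})$ is a global minimizer of $f$ on $\mathbf{\Omega}$.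
   Context: Notation: $\mathbb{N}^d_{k}=\{\boldsymbol\alpha\in\mathbb{N}^d:\sum_i\alpha_i\le k\}$. SOS-convexity: a polynomial $p\in\mathbb{R}[\mathbf{x}]$ is SOS-convex if there is a matrix polynomial $\mathbf{L}\in\mathbb{R}[\mathbf{x}]^{d\times r}$ (for some $r$) with $\nabla^2p(\mathbf{x})=\mathbf{L}(\mathbf{x})\mathbf{L}(\mathbf{x})^\top$ for all $\mathbf{x}\in\mathbb{R}^d$; $p$ is SOS-concave if $-p$ is SOS-convex. Riesz functional: for a real sequence $\boldsymbol{\phi}=(\phi_{\boldsymbol\alpha})_{\boldsymbol\alpha\in\mathbb{N}^d_{2n}}$, $\phi$ is the linear functional on polynomials of degree at most $2n$ given by $\phi\big(\sum_{\boldsymbol\alpha} p_{\boldsymbol\alpha}\mathbf{x}^{\boldsymbol\alpha}\big)=\sum_{\boldsymbol\alpha} p_{\boldsymbol\alpha}\phi_{\boldsymbol\alpha}$. Localizing matrix: for a polynomial $g$ and $k\in\mathbb{N}$ with $2k+\deg g\le 2n$, $\mathbf{M}_k(g\cdot\boldsymbol{\phi})$ is the real symmetric matrix with rows and columns indexed by $\mathbb{N}^d_k$ and entry $(\boldsymbol\alpha,\boldsymbol\beta)$ equal to $\phi(\mathbf{x}^{\boldsymbol\alpha+\boldsymbol\beta}g)$. For $g=g_0=1$ (with $d_0=0$) this is the moment matrix $\mathbf{M}_n(\boldsymbol{\phi})$. $\mathbf{A}\succeq\mathbf{0}$ means that $\mathbf{A}$ is positive semidefinite. Optimal solution: a feasible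 $\boldsymbol{\phi}$ attaining the minimum value $\rho_n$, i.e. $\phi(f)=\rho_n$. Convention: the zero polynomial is given degree $0$, so $a_j\ge 0$ for all $j$. With this convention the bound on $n$ in (2) implies $n\ge n_{\min}$. *)

(* Defs.v *)
From mathcomp Require Import all_boot all_order all_algebra.
(* A development that also needs all_analysis must import it after mpoly: in the
   other order their notations clash. *)
From mathcomp Require Import mpoly.
From mathcomp Require Import classical_sets reals.

Set Implicit Arguments.
Unset Strict Implicit.
Unset Printing Implicit Defensive.

Import Order.TTheory GRing.Theory Num.Theory.
Local Open Scope ring_scope.
Local Open Scope classical_set_scope.

Section Polynomials.
Context {R : realType} {d : nat}.

(* [msize p] is one more than the total degree, and 0 for p = 0; hence the zero
   polynomial has degree 0 here. *)
Definition mpdeg (p : {mpoly R[d]}) : nat := (msize p).-1.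

(* uphalf k is the ceiling of k / 2. *)
Definition halfdeg (p : {mpoly R[d]}) : nat := uphalf (mpdeg p).

Definition mxdeg {r s : nat} (L : 'M[{mpoly R[d]}]_(r, s)) : nat :=
  \max_(k < r) \max_(l < s) mpdeg (L k l).

Definition mxeval (x : 'I_d -> R) {r s : nat} (L : 'M[{mpoly R[d]}]_(r, s)) :
  'M[R]_(r, s) := map_mx (meval x) L.

Definition hessian (p : {mpoly R[d]}) : 'M[{mpoly R[d]}]_d :=
  \matrix_(i, j) (p^`M(i))^`M(j).

Definition sos_convex (p : {mpoly R[d]}) : Prop :=
  exists (r : nat) (L : 'M[{mpoly R[d]}]_(d, r)),
    forall x : 'I_d -> R,
      mxeval x (hessian p) = mxeval x L *m (mxeval x L)^T.

Definition sos_concave (p : {mpoly R[d]}) : Prop := sos_convex (- p).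

(* The index j : 'I_m.+2 ranges over {0, ..., m+1}: g_0 is [g ord0] and
   g_(m+1) is [g ord_max]. *)

Definition hessian_Qmodule_cert {m : nat} (f : {mpoly R[d]})
    (g : 'I_m.+2 -> {mpoly R[d]}) (r : 'I_m.+2 -> nat)
    (L : forall j : 'I_m.+2, 'M[{mpoly R[d]}]_(d, r j)) : Prop :=
  forall x : 'I_d -> R,
    mxeval x (hessian f) =
    \sum_(j < m.+2) (g j).@[x] *: (mxeval x (L j) *m (mxeval x (L j))^T).

Definition Omega {m : nat} (g : 'I_m.+2 -> {mpoly R[d]}) : set ('I_d -> R) :=
  [set x | forall j : 'I_m.+2, j != ord0 -> 0 <= (g j).@[x]].

End Polynomials.

Definition psd {R : realType} {N : nat} (A : 'M[R]_N) : Prop :=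
  A^T = A /\ forall v : 'cV[R]_N, 0 <= (v^T *m A *m v) 0 0.

(* Sequences indexed by the multi-indices of total degree at most 2n. *)
Definition momseq (R : realType) (d n : nat) : Type :=
  'X_{1..d < n.*2.+1} -> R.

Section Relaxation.
Context {R : realType} {d : nat}.

(* Only meaningful for mpdeg p <= 2n: coefficients of higher degree are
   ignored. *)
Definition riesz {n : nat} (phi : momseq R d n) (p : {mpoly R[d]}) : R :=
  \sum_(alpha : 'X_{1..d < n.*2.+1}) p@_alpha * phi alpha.

(* Rows and columns are indexed by the multi-indices of total degree at most k,
   listed by [enum_val]. *)
Definition locmx {n : nat} (k : nat) (g : {mpoly R[d]}) (phi : momseq R d n) :
  'M[R]_#|{: 'X_{1..d < k.+1}}| :=
  \matrix_(i, j)
    let alpha : 'X_{1..d < k.+1} := enum_val i in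
    let beta : 'X_{1..d < k.+1} := enum_val j in
    riesz phi ('X_[alpha + beta] * g).

Definition feasible {m n : nat} (g : 'I_m.+2 -> {mpoly R[d]})
    (phi : momseq R d n) : Prop :=
  riesz phi 1 = 1 /\
  forall j : 'I_m.+2, psd (locmx (n - halfdeg (g j)) (g j) phi).

Definition optimal {m n : nat} (f : {mpoly R[d]})
    (g : 'I_m.+2 -> {mpoly R[d]}) (phi : momseq R d n) : Prop :=
  feasible g phi /\
  forall psi : momseq R d n, feasible g psi -> riesz phi f <= riesz psi f.

(* [rho] and [fstar] are written as infima; they are the minima as soon as these
   are attained, [rho f g n] then being [riesz phi f] for any optimal phi. *)
Definition rho {m : nat} (f : {mpoly R[d]}) (g : 'I_m.+2 -> {mpoly R[d]})
    (n : nat) : R :=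
  inf [set riesz phi f | phi in [set phi : momseq R d n | feasible g phi]].

Definition fstar {m : nat} (f : {mpoly R[d]})
    (g : 'I_m.+2 -> {mpoly R[d]}) : R :=
  inf [set f.@[x] | x in Omega g].

Definition n_min {m : nat} (f : {mpoly R[d]}) (g : 'I_m.+2 -> {mpoly R[d]}) :
  nat := maxn (\max_(j < m.+2) halfdeg (g j)) (halfdeg f).

Definition first_moments {n : nat} (phi : momseq R d n) : 'I_d -> R :=
  fun i => riesz phi 'X_i.

End Relaxation.

(* Main.v *)
(* Let phi be feasible with first moments y and put F(t) = phi(f(y + t(x - y))),
   a polynomial in t with F(0) = f(y), F'(0) = 0 and F(1) = phi(f). By the
   certificate, F''(t) is a sum of terms phi(g_j(y + t(x - y)) q(x)^2), where
   deg q <= a_j + 1. For j >= 1 such a term is itself a concave polynomial in t,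
   because - hess g_j = L L^T makes minus its second derivative a sum of values
   of phi on squares; so it lies above its chord
   t phi(g_j q^2) + (1 - t) g_j(y) phi(q^2) >= 0. Hence F is convex on [0, 1]
   and f(y) <= phi(f). The same tangent inequality for - g_j gives
   g_j(y) >= phi(g_j) >= 0, so y lies in Omega, and an optimal phi satisfies
   f(y) <= phi(f) <= f(x) for every x in Omega, the point evaluations being
   feasible. For existence, g_(m+1) = 1 - |x|^2 bounds all moments by 1, so the
   feasible set is compact. *)
From HB Require Import structures.
Require Import Defs.
From mathcomp Require Import all_boot all_order all_algebra.
From mathcomp Require Import mpoly.
From mathcomp Require Import classical_sets reals.
From mathcomp Require Import topology normedtype polyrcf ring lra zify.
(* Not imported: its notation for derivatives hides that of polynomials. *)
From mathcomp Require derive.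

Set Implicit Arguments.
Unset Strict Implicit.
Unset Printing Implicit Defensive.

Import Order.TTheory GRing.Theory Num.Theory.
Local Open Scope ring_scope.
Local Open Scope classical_set_scope.

(** * Degrees of multivariate polynomials *)

Lemma mnm_neq0 (d : nat) (m : 'X_{1..d}) : m != 0%MM -> exists i, m i != 0%N.
Proof.
move=> m0; apply/existsP; apply: contra_neqT m0.
rewrite negb_exists => /forallP h; apply/mnmP => i; rewrite mnm0E.
by apply/eqP; rewrite -[_ == _]negbK.
Qed.

(** Sizes are degrees plus one, so a product loses one unit; it is charged to the bound on [q],
    which avoids a truncated predecessor. *)
Lemma leq_msizeM (R : idomainType) (d a b : nat) (p q : {mpoly R[d]}) :
  (msize p <= a)%N -> (msize q <= b.+1)%N -> (msize (p * q) <= a + b)%N.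
Proof.
have [->|p0] := eqVneq p 0; first by rewrite mul0r msize0.
have [->|q0] := eqVneq q 0; first by rewrite mulr0 msize0.
by rewrite msizeM //; lia.
Qed.

Lemma leq_msize_sum (R : nzRingType) (d a : nat) (I : Type) (s : seq I)
    (P : pred I) (F : I -> {mpoly R[d]}) :
  (forall i, P i -> (msize (F i) <= a)%N) ->
  (msize (\sum_(i <- s | P i) F i) <= a)%N.
Proof.
move=> hF; apply: (big_ind (fun p => (msize p <= a)%N)) => //.
  by rewrite msize0.
by move=> p q hp hq; apply: leq_trans (msizeD_le _ _) _; rewrite geq_max hp.
Qed.

(** Affine forms put into a monomial of degree $s$ give a product of $s$ factors of degree at most
    one. *)
Lemma leq_msize_subst (R : idomainType) (d e k : nat) (p : {mpoly R[d]})
    (z : 'I_d -> {mpoly R[e]}) :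
  (msize p <= k)%N -> (forall i, (msize (z i) <= 2)%N) ->
  (msize (mmap (@mpolyC e R) z p) <= k)%N.
Proof.
move=> pk zle; rewrite (mmapE _ pk); apply: leq_msize_sum => m _.
rewrite mul_mpolyC (leq_trans (msizeZ_le _ _)) //.
apply: leq_trans (valP m); rewrite /= mdegE /mmap1.
apply: (big_rec2 (fun q s => (msize q <= s.+1)%N)); first by rewrite msize1.
move=> i s q _ qs; rewrite -addSn; apply: leq_msizeM => //.
elim: (m i) => [|l IHl]; first by rewrite expr0 msize1.
by rewrite exprSr -addn1; apply: leq_msizeM.
Qed.

(* The squares of the largest leading monomials cannot cancel in the sum. *)
Lemma msize_sum_sqr (R : realDomainType) (d r : nat)
    (h : 'I_r -> {mpoly R[d]}) (k : 'I_r) :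
  ((msize (h k)).*2 <= (msize (\sum_l h l ^+ 2)%R).+1)%N.
Proof.
have [->|hk0] := eqVneq (h k) 0; first by rewrite msize0.
have [l hl0 lmax] :=
  @arg_maxP _ _ _ k (fun i => h i != 0) (fun i => mlead (h i)) hk0.
set mm := mlead (h l) in lmax.
have lek j : (mlead (h j) <= mm)%O.
  by have [->|/lmax//] := eqVneq (h j) 0; rewrite mlead0 le0x.
have cE : (\sum_l h l ^+ 2)@_(mm + mm) = \sum_l ((h l)@_mm) ^+ 2.
  rewrite raddf_sum /=; apply: eq_bigr => j _.
  by rewrite expr2 mleadcMW ?expr2.
have c0 : (\sum_l h l ^+ 2)@_(mm + mm) != 0.
  rewrite cE psumr_neq0 => [|j _]; last exact: sqr_ge0.
  apply/hasP; exists l; first by rewrite mem_index_enum.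
  by rewrite /= exprn_even_gt0 //= mleadc_eq0.
have := msize_mdeg_lt (m := (mm + mm)%MM) (p := \sum_l h l ^+ 2).
rewrite mcoeff_msupp c0 mdegD => /(_ isT).
(* The monomial order refines the total degree, so [h k] has degree at most that of [mm]. *)
have := lemc_mdeg (lek k); rewrite -(mlead_deg hk0); lia.
Qed.

Lemma msize_mderiv (R : nzRingType) (d : nat) (p : {mpoly R[d]}) i :
  (msize p^`M(i) <= (msize p).-1)%N.
Proof.
rewrite msizeE; apply/bigmax_leqP_seq => m.
rewrite mcoeff_msupp mcoeff_mderiv => c0 _.
have /msize_mdeg_lt : (m + U_(i))%MM \in msupp p.
  by rewrite mcoeff_msupp; apply: contra_neq c0 => ->; rewrite mul0rn.
rewrite mdegD mdeg1; lia.
Qed.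

(** * Polynomials along a segment *)

Section Path.
Context {R S : comNzRingType} {d : nat}.
Variables (c : {rmorphism R -> S}) (a b : 'I_d -> S).

(** The map [c] is the identity for restriction to a real line, and the embedding of constants when
    the direction is itself polynomial. *)
Definition mpath : {mpoly R[d]} -> {poly S} :=
  mmap (polyC \o c) (fun i => (a i)%:P + (b i)%:P * 'X).

HB.instance Definition _ := GRing.RMorphism.on mpath.

Lemma mpathX i : mpath 'X_i = (a i)%:P + (b i)%:P * 'X.
Proof. by rewrite /mpath mmapX mmap1U. Qed.

(** Chain rule: the identity is stable under sums and products and holds for constants and
    variables, which generate all polynomials. *)
Lemma deriv_mpath p :
  (mpath p)^`() = \sum_i (b i)%:P * mpath p^`M(i).
Proof.
pose C q := (mpath q)^`() = \sum_i (b i)%:P * mpath q^`M(i).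
have CD q1 q2 : C q1 -> C q2 -> C (q1 + q2).
  move=> Cp Cq; rewrite /C rmorphD derivD Cp Cq -big_split /=.
  by apply: eq_bigr => i _; rewrite mderivD rmorphD mulrDr.
have CM q1 q2 : C q1 -> C q2 -> C (q1 * q2).
  move=> Cp Cq; rewrite /C rmorphM derivM Cp Cq.
  rewrite mulr_suml mulr_sumr -big_split /=.
  by apply: eq_bigr => i _; rewrite mderivM rmorphD !rmorphM /=; ring.
have CC k : C k%:MP.
  rewrite /C /mpath mmapC derivC big1 // => i _.
  by rewrite mderivC mmap0 mulr0.
have CX i : C 'X_i.
  rewrite /C mpathX derivD derivC add0r deriv_mulC derivX mulr1.
  rewrite (bigD1 i) //= mderivX mnm1E eqxx scale1r.
  have -> : (U_(i) - U_(i))%MM = 0%MM :> 'X_{1..d}.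
    by apply/mnmP => j; rewrite mnmBE subnn mnm0E.
  rewrite mpolyX0 rmorph1 mulr1 big1 ?addr0 // => j ji.
  by rewrite mderivX mnm1E eq_sym (negPf ji) scale0r rmorph0 mulr0.
rewrite -/(C p); elim/mpolyind: p => [|k m q _ _ Cq]; first exact: (CC 0).
apply: (CD) => //; rewrite -mul_mpolyC; apply: (CM) => //.
rewrite mpolyXE_id; apply: (big_ind C (CC 1) CM) => i _.
by elim: (m i) => [|l IHl]; [exact: (CC 1)|rewrite exprS; apply: CM].
Qed.

Lemma horner_mpath p t :
  (mpath p).[t] = mmap c (fun i => a i + b i * t) p.
Proof.
rewrite /mpath /mmap horner_sum; apply: eq_bigr => m _.
rewrite hornerM hornerC /mmap1 horner_prod; congr (_ * _).
by apply: eq_bigr => i _; rewrite horner_exp !hornerE.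
Qed.

Lemma deriv2_mpath p :
  (mpath p)^`()^`() =
  \sum_i \sum_j ((b i)%:P * (b j)%:P) * mpath p^`M(i)^`M(j).
Proof.
rewrite deriv_mpath raddf_sum /=; apply: eq_bigr => i _.
rewrite deriv_mulC deriv_mpath mulr_sumr; apply: eq_bigr => j _.
by rewrite mulrA.
Qed.

(** The second derivative is the Hessian form at the direction $b$, which a Hessian $\sum_j h_j L_j
    L_j^T$ turns into $\sum_j h_j |L_j^T b|^2$. *)
Lemma deriv2_mpath_cert (N : nat) (r : 'I_N -> nat) (h : 'I_N -> {mpoly R[d]})
    (L : forall j, 'M[{mpoly R[d]}]_(d, r j)) p :
  (forall i k, p^`M(i)^`M(k) = \sum_j h j * \sum_l L j i l * L j k l) ->
  (mpath p)^`()^`() =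
  \sum_j mpath (h j) * \sum_l (\sum_i (b i)%:P * mpath (L j i l)) ^+ 2.
Proof.
move=> hess; rewrite deriv2_mpath.
under eq_bigr do under eq_bigr do rewrite hess rmorph_sum mulr_sumr /=.
under eq_bigr do rewrite exchange_big.
rewrite exchange_big; apply: eq_bigr => j _ /=.
rewrite (eq_bigr _ (fun l _ => expr2 _)).
rewrite (eq_bigr _ (fun l _ => big_distrlr _ _ _ _ _ _ _)) /=.
rewrite exchange_big [X in _ = _ * X]exchange_big [RHS]mulr_sumr.
apply: eq_bigr => i _ /=.
rewrite [X in _ = _ * X]exchange_big [RHS]mulr_sumr; apply: eq_bigr => k _ /=.
rewrite rmorphM rmorph_sum !mulr_sumr; apply: eq_bigr => l _ /=.
by rewrite rmorphM /=; ring.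
Qed.

End Path.

(** * Polynomials that vanish as functions *)

Lemma meval_mderiv_eq0 (R : numDomainType) (d : nat) (p : {mpoly R[d]}) i :
  (forall x, p.@[x] = 0) -> forall x, p^`M(i).@[x] = 0.
Proof.
(* Restricted to the line through [x] in the [i]-th direction, [p] is a univariate polynomial with
   too many roots; its derivative at 0 is the partial derivative. *)
move=> p0 x; pose P := mpath idfun x (fun j => (j == i)%:R) p.
have P0 : P = 0.
  apply: (@roots_geq_poly_eq0 _ _ (map (fun k => k%:R) (iota 0 (size P)))).
  - by apply/allP => t _; rewrite /root horner_mpath -/(meval _ _) p0.
  - by rewrite map_inj_uniq ?iota_uniq // => k l /eqP; rewrite eqr_nat => /eqP.
  - by rewrite size_map size_iota.
have := congr1 (fun q => q.[0]) (deriv_mpath idfun x (fun j => (j == i)%:R) p).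
rewrite -/P P0 raddf0 horner0 horner_sum (bigD1 i) //= big1 => [|j ji].
  rewrite eqxx addr0 hornerM hornerC mul1r horner_mpath => /esym <-.
  by apply: meval_eq => j; rewrite mulr0 addr0.
by rewrite (negPf ji) hornerM hornerC mul0r.
Qed.

(** Induction on the degree: the partial derivatives vanish as functions, hence are zero, and in
    characteristic 0 this leaves a constant. *)
Lemma mpoly_vanish (R : numDomainType) (d : nat) (p : {mpoly R[d]}) :
  (forall x, p.@[x] = 0) -> p = 0.
Proof.
elim: {p}(msize p) {-2}p (leqnn (msize p)) => [p|k IHk p pk p0].
  by rewrite leqn0 msize_poly_eq0 => /eqP.
have dp0 i : p^`M(i) = 0.
  apply: IHk; last exact: meval_mderiv_eq0.
  by apply: leq_trans (msize_mderiv _ _) _; lia.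
suff pC : p = (p@_0)%:MP.
  by have := p0 (fun=> 0); rewrite pC mevalC => ->; rewrite mpolyC0.
apply: msize1_polyC; rewrite msizeE; apply/bigmax_leqP_seq => m.
rewrite mcoeff_msupp => pm _; rewrite ltnS leqn0 mdeg_eq0.
apply: contraNT pm => /mnm_neq0[i mi].
have := mcoeff_mderiv i p (m - U_(i))%MM; rewrite dp0 mcoeff0 submK.
  by move=> /esym/eqP; rewrite mulrn_eq0.
by rewrite lep1mP.
Qed.

Lemma mpoly_eq_fun (R : numDomainType) (d : nat) (p q : {mpoly R[d]}) :
  (forall x, p.@[x] = q.@[x]) -> p = q.
Proof.
move=> pq; apply/eqP; rewrite -subr_eq0; apply/eqP/mpoly_vanish => x.
by rewrite mevalB pq subrr.
Qed.

(** * Convex univariate polynomials *)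

Lemma convex_poly_tangent (R : rcfType) (P : {poly R}) :
  (forall t, 0 < t < 1 -> 0 <= P^`()^`().[t]) ->
  P.[0] + P^`().[0] <= P.[1].
Proof.
move=> P2; have [c /andP[c0 c1] e] := poly_mvt P (@ltr01 R).
rewrite /= !bnd_simp in c0 c1.
have [b /andP[b0 b1] e'] := poly_mvt P^`() c0; rewrite /= !bnd_simp in b0 b1.
have : 0 <= P^`()^`().[b] * c.
  by rewrite mulr_ge0 ?P2 ?(ltW c0) // b0 (lt_trans b1).
rewrite subr0 in e'; rewrite -e'; move: e; rewrite subr0 mulr1; lra.
Qed.

Lemma convex_poly_chord (R : rcfType) (P : {poly R}) (t : R) :
  (forall t, 0 < t < 1 -> 0 <= P^`()^`().[t]) -> 0 < t < 1 ->
  P.[t] <= t * P.[1] + (1 - t) * P.[0].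
Proof.
move=> P2 /andP[t0 t1].
have [u /andP[u0 u1] e] := poly_mvt P t0.
have [v /andP[v0 v1] e'] := poly_mvt P t1; rewrite /= !bnd_simp in u0 u1 v0 v1.
have uv : u < v by apply: lt_trans v0.
have [b /andP[b0 b1] e2] := poly_mvt P^`() uv; rewrite /= !bnd_simp in b0 b1.
have le : P^`().[u] <= P^`().[v].
  rewrite -subr_ge0 e2 mulr_ge0 ?subr_ge0 ?(ltW uv) // P2 //.
  by rewrite (lt_trans u0) // (lt_trans b1).
(* This product is exactly the gap between the chord and $P(t)$. *)
have : 0 <= (P^`().[v] - P^`().[u]) * (t * (1 - t)).
  by rewrite mulr_ge0 ?subr_ge0 // mulr_ge0 ?subr_ge0 ?(ltW t0) ?(ltW t1).
move: e e'; rewrite subr0; nra.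
Qed.

(** * Riesz functionals *)

Section Riesz.
Context {R : realType} {d n : nat}.
Implicit Types (phi : momseq R d n) (p q : {mpoly R[d]}).

Lemma riesz_is_scalar phi : scalar (riesz phi).
Proof.
move=> k p q; rewrite /riesz mulr_sumr -big_split /=; apply: eq_bigr => m _.
by rewrite mcoeffD mcoeffZ mulrDl mulrA.
Qed.

HB.instance Definition _ phi :=
  GRing.isLinear.Build R {mpoly R[d]} R _ (riesz phi) (riesz_is_scalar phi).

Lemma rieszZ phi k p : riesz phi (k *: p) = k * riesz phi p.
Proof. exact: linearZ. Qed.

Lemma riesz_quad k g phi (v : 'cV_ #|{: 'X_{1..d < k.+1}}|) :
  (v^T *m locmx k g phi *m v) 0 0 =
  riesz phi (g * (\sum_i v i 0 *: 'X_[enum_val i]) ^+ 2).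
Proof.
rewrite expr2 big_distrlr exchange_big mulr_sumr linear_sum mxE /=.
apply: eq_bigr => j _.
rewrite mxE mulr_suml mulr_sumr linear_sum /=; apply: eq_bigr => i _.
rewrite !mxE -scalerAl -!scalerAr !rieszZ -mpolyXD mulrC [g * _]mulrC.
by rewrite mulrCA.
Qed.

(** A vector lists the coefficients of a polynomial $q$ of degree at most [k], and the quadratic
    form of the matrix there is $\phi(g q^2)$. *)
Lemma psd_locmxP k g phi :
  psd (locmx k g phi) <->
  (forall q, (msize q <= k.+1)%N -> 0 <= riesz phi (g * q ^+ 2)).
Proof.
split=> [[_ M_ge0] q qk|M_ge0].
  have := M_ge0 (\col_i q@_(enum_val i : 'X_{1..d < k.+1})); rewrite riesz_quad.
  rewrite [in X in _ -> X](mpolywE qk).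
  rewrite [in X in _ -> X](reindex _ (onW_bij _ (enum_val_bij _))) /=.
  by under eq_bigr do rewrite mxE.
split; first by apply/matrixP => i j; rewrite !mxE /= addmC.
move=> v; rewrite riesz_quad; apply: M_ge0; apply: leq_msize_sum => i _.
apply: leq_trans (msizeZ_le _ _) _; rewrite msizeX; exact: valP (enum_val i).
Qed.

Lemma riesz_mono phi (a : 'X_{1..d < n.*2.+1}) : riesz phi 'X_[a] = phi a.
Proof.
rewrite /riesz (bigD1 a) //= mcoeffX eqxx mul1r big1 ?addr0 // => b ba.
by rewrite mcoeffX eq_sym val_eqE (negPf ba) mul0r.
Qed.

Definition moments_at (x : 'I_d -> R) : momseq R d n := fun a => mmap1 x a.

Lemma riesz_moments_at x p :
  (msize p <= n.*2.+1)%N -> riesz (moments_at x) p = p.@[x].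
Proof. by move=> pn; rewrite /meval (mmapE _ pn). Qed.

End Riesz.

(** At a real $t$ the powers of $t$ are scalars, so linearity pulls them out of [Phi]. *)
Lemma horner_map_scalar (R : comNzRingType) (d : nat)
    (Phi : {scalar {mpoly R[d]}}) (P : {poly {mpoly R[d]}}) t :
  (map_poly Phi P).[t] = Phi P.[t%:MP].
Proof.
rewrite horner_poly horner_coef raddf_sum /=; apply: eq_bigr => i _.
by rewrite -rmorphXn mulrC -[P`_i * _]mulrC mul_mpolyC linearZ.
Qed.

Lemma deriv_map_additive (R S : nzRingType) (Phi : {additive R -> S})
    (P : {poly R}) : (map_poly Phi P)^`() = map_poly Phi P^`().
Proof.
by apply/polyP => i; rewrite coef_deriv !coef_map coef_deriv raddfMn.
Qed.

(** * Riesz functionals along a segment *)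

Section Segment.
Context {R : realType} {d n : nat}.
Variables (phi : momseq R d n) (y : 'I_d -> R).
Implicit Types (p q w : {mpoly R[d]}).

Definition wriesz w p := riesz phi (p * w).

Lemma wriesz_is_scalar w : scalar (wriesz w).
Proof. by move=> k p q; rewrite /wriesz mulrDl -scalerAl linearP. Qed.

HB.instance Definition _ w :=
  GRing.isLinear.Build R {mpoly R[d]} R _ (wriesz w) (wriesz_is_scalar w).

(* [segm p] is [p (y + T (x - y))], a polynomial in [T] over [R[x]]. *)
Definition segm : {mpoly R[d]} -> {poly {mpoly R[d]}} :=
  mpath (@mpolyC d R) (fun i => (y i)%:MP) (fun i => 'X_i - (y i)%:MP).

HB.instance Definition _ := GRing.RMorphism.on segm.

Lemma segm0 p : (segm p).[0] = (p.@[y])%:MP.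
Proof.
rewrite horner_mpath /mmap mevalE rmorph_sum; apply: eq_bigr => m _.
rewrite rmorphM rmorph_prod /mmap1; congr (_ * _); apply: eq_bigr => i _.
by rewrite mulr0 addr0 rmorphXn.
Qed.

Lemma segm1 p : (segm p).[1] = p.
Proof.
rewrite horner_mpath [RHS]mpolyE /mmap; apply: eq_bigr => m _.
rewrite mul_mpolyC mpolyXE_id; congr (_ *: _); apply: eq_bigr => i _.
by rewrite mulr1 addrC subrK.
Qed.

Lemma msize_segm k p t : (msize p <= k)%N -> (msize (segm p).[t%:MP] <= k)%N.
Proof.
move=> pk; rewrite horner_mpath; apply: leq_msize_subst => // i.
rewrite (leq_trans (msizeD_le _ _)) // geq_max.
have C1 (c : R) : (msize c%:MP_[d] <= 1)%N by rewrite msizeC; case: eqP.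
rewrite (leq_trans (C1 _)) //= mulrC mul_mpolyC.
rewrite (leq_trans (msizeZ_le _ _)) // (leq_trans (msizeD_le _ _)) // geq_max.
by rewrite msizeX mdeg1 /= msizeN (leq_trans (C1 _)).
Qed.

(** The direction $x - y$ has degree one in $x$ and costs one degree: this is the 1 in the lower
    bound on $n$. *)
Lemma msize_segm_dir k r (L : 'M[{mpoly R[d]}]_(d, r)) l t :
  (forall i, (msize (L i l) <= k)%N) ->
  (msize (\sum_i ('X_i - (y i)%:MP)%:P * segm (L i l)).[t%:MP] <= k.+1)%N.
Proof.
move=> Lk; rewrite horner_sum; apply: leq_msize_sum => i _.
rewrite hornerM hornerC mulrC -addn1; apply: leq_msizeM.
  exact: msize_segm.
rewrite (leq_trans (msizeD_le _ _)) // geq_max msizeX mdeg1 msizeN /=.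
by rewrite msizeC; case: eqP.
Qed.

Lemma deriv2_segm (N : nat) (r : 'I_N -> nat) (h : 'I_N -> {mpoly R[d]})
    (L : forall j, 'M[{mpoly R[d]}]_(d, r j)) p t :
  (forall i k, p^`M(i)^`M(k) = \sum_j h j * \sum_l L j i l * L j k l) ->
  (segm p)^`()^`().[t%:MP] =
  \sum_j (segm (h j)).[t%:MP] *
    \sum_l (\sum_i ('X_i - (y i)%:MP)%:P * segm (L j i l)).[t%:MP] ^+ 2.
Proof.
move=> hess; rewrite (deriv2_mpath_cert _ _ _ hess) horner_sum.
apply: eq_bigr => j _; rewrite hornerM [X in _ * X]horner_sum; congr (_ * _).
by apply: eq_bigr => l _; rewrite horner_exp.
Qed.

(** The real polynomial $t \mapsto \phi(p(y + t(x - y))\,w)$, where $\phi$ acts in $x$. *)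
Definition segm_riesz w p : {poly R} := map_poly (wriesz w) (segm p).

Lemma segm_riesz0 w p : (segm_riesz w p).[0] = p.@[y] * riesz phi w.
Proof.
by rewrite horner_map_scalar rmorph0 segm0 /= /wriesz mul_mpolyC rieszZ.
Qed.

Lemma segm_riesz1 w p : (segm_riesz w p).[1] = riesz phi (p * w).
Proof. by rewrite horner_map_scalar rmorph1 segm1. Qed.

Lemma deriv2_segm_riesz w p t :
  (segm_riesz w p)^`()^`().[t] = riesz phi ((segm p)^`()^`().[t%:MP] * w).
Proof. by rewrite !deriv_map_additive horner_map_scalar. Qed.

End Segment.

(** * Feasibility and Hessian certificates *)

Lemma msize_halfdeg (R : realType) (d : nat) (p : {mpoly R[d]}) :
  (msize p <= (halfdeg p).*2.+1)%N.
Proof.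
rewrite (leq_trans (leqSpred _)) // ltnS -leq_uphalf_double; exact: leqnn.
Qed.

Lemma halfdegN (R : realType) (d : nat) (p : {mpoly R[d]}) :
  halfdeg (- p) = halfdeg p.
Proof. by rewrite /halfdeg /mpdeg msizeN. Qed.

Lemma feasibleP (R : realType) (d m n : nat) (g : 'I_m.+2 -> {mpoly R[d]})
    (phi : momseq R d n) :
  feasible g phi <->
  riesz phi 1 = 1 /\
  forall j q, (msize q <= (n - halfdeg (g j)).+1)%N ->
    0 <= riesz phi (g j * q ^+ 2).
Proof.
split=> -[phi1 psdg]; split=> // j; first exact/psd_locmxP/psdg.
by apply/psd_locmxP; exact: psdg.
Qed.

(** Evaluation gives $g_j(x) q(x)^2 \ge 0$; the rest checks that $g_j q^2$ has degree at most $2n$,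
    so that [riesz] sees all its coefficients. *)
Lemma feasible_moments_at (R : realType) (d m n : nat)
    (g : 'I_m.+2 -> {mpoly R[d]}) (x : 'I_d -> R) :
  g ord0 = 1 -> (forall j, halfdeg (g j) <= n)%N -> Omega g x ->
  feasible g (moments_at x : momseq R d n).
Proof.
move=> g0 gn xO; apply/feasibleP; split.
  by rewrite riesz_moments_at ?msize1 // meval1.
move=> j q qn; rewrite riesz_moments_at.
  rewrite mevalM expr2 mevalM -expr2 mulr_ge0 ?sqr_ge0 //.
  by have [->|/xO//] := eqVneq j ord0; rewrite g0 meval1.
have qq : (msize (q * q) <= (n - halfdeg (g j)).*2.+1)%N.
  rewrite -addnn -addSn; exact: leq_msizeM.
have := gn j; have [->|q0] := eqVneq q 0; first by rewrite expr0n mulr0 msize0.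
have [->|gj0] := eqVneq (g j) 0; first by rewrite mul0r msize0.
rewrite expr2 msizeM ?mulf_neq0 // => gnj.
apply: (@leq_trans ((halfdeg (g j)).*2.+1 + (n - halfdeg (g j)).*2.+1).-1);
  last by lia.
by rewrite -!subn1 leq_sub2r // leq_add // msize_halfdeg.
Qed.

(** The certificates are pointwise; applying $\phi$ requires identities between polynomials. *)
Lemma hess_entries (R : realType) (d r : nat) (p : {mpoly R[d]})
    (L : 'M[{mpoly R[d]}]_(d, r)) :
  (forall x, mxeval x (hessian p) = mxeval x L *m (mxeval x L)^T) ->
  forall i k, p^`M(i)^`M(k) = \sum_l L i l * L k l.
Proof.
move=> hess i k; apply: mpoly_eq_fun => x.
have := congr1 (fun M : 'M_d => M i k) (hess x); rewrite !mxE => ->.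
by rewrite raddf_sum; apply: eq_bigr => l _; rewrite !mxE /= mevalM.
Qed.

Lemma Qmodule_cert_entries (R : realType) (d m : nat) (f : {mpoly R[d]})
    (g : 'I_m.+2 -> {mpoly R[d]}) (r : 'I_m.+2 -> nat)
    (L : forall j : 'I_m.+2, 'M[{mpoly R[d]}]_(d, r j)) :
  hessian_Qmodule_cert f g L ->
  forall i k, f^`M(i)^`M(k) = \sum_j g j * \sum_l L j i l * L j k l.
Proof.
move=> hess i k; apply: mpoly_eq_fun => x.
have := congr1 (fun M : 'M_d => M i k) (hess x); rewrite !mxE => ->.
rewrite summxE raddf_sum; apply: eq_bigr => j _.
rewrite !mxE /= mevalM raddf_sum; congr (_ * _).
by apply: eq_bigr => l _; rewrite !mxE /= mevalM.
Qed.

(* The diagonal entries make [p^`M(i)^`M(i)] a sum of squares. *)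
Lemma msize_sos_factor (R : realType) (d r : nat) (p : {mpoly R[d]})
    (L : 'M[{mpoly R[d]}]_(d, r)) :
  (forall i k, p^`M(i)^`M(k) = \sum_l L i l * L k l) ->
  forall i l, (msize (L i l) <= halfdeg p)%N.
Proof.
move=> hess i l.
have L2 : ((msize (L i l)).*2 <= (msize p^`M(i)^`M(i)).+1)%N.
  rewrite hess; under eq_bigr do rewrite -expr2; exact: msize_sum_sqr.
have p1 : (msize p^`M(i) <= (msize p).-1)%N := msize_mderiv p i.
have p2 : (msize p^`M(i)^`M(i) <= (msize p^`M(i)).-1)%N := msize_mderiv _ i.
have p0 : (msize p <= (halfdeg p).*2.+1)%N := msize_halfdeg p.
lia.
Qed.

(** * Jensen inequalities *)

Section Jensen.
Context {R : realType} {d n : nat}.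
Variable phi : momseq R d n.
Hypothesis phi1 : riesz phi 1 = 1.
Hypothesis phi_sqr : forall q, (msize q <= n.+1)%N -> 0 <= riesz phi (q ^+ 2).
Let y := first_moments phi.

Lemma riesz_tangent p :
  (forall t, 0 < t < 1 -> 0 <= riesz phi (segm y p)^`()^`().[t%:MP]) ->
  p.@[y] <= riesz phi p.
Proof.
move=> p2; have := @convex_poly_tangent R (segm_riesz phi y 1 p).
(* At 0 the gradient is the constant $\nabla p(y)$, and $\phi(x_i - y_i) = 0$ by the choice of $y$
   and $\phi(1) = 1$. *)
have -> : (segm_riesz phi y 1 p)^`().[0] = 0.
  rewrite deriv_map_additive horner_map_scalar deriv_mpath horner_sum.
  rewrite raddf_sum big1 // => i _.
  rewrite rmorph0 hornerM hornerC -/(segm y _) segm0 /= /wriesz mulr1 mulrC.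
  rewrite mul_mpolyC rieszZ raddfB /= -[(y i)%:MP]mulr1 mul_mpolyC rieszZ phi1.
  by rewrite mulr1 /y /first_moments subrr mulr0.
rewrite segm_riesz0 segm_riesz1 phi1 addr0 !mulr1; apply=> t t01.
rewrite deriv2_segm_riesz mulr1; exact: p2.
Qed.

Lemma riesz_sos_convex g q (e : nat) t :
  sos_convex g -> (msize q <= e.+1)%N -> (halfdeg g + e <= n)%N ->
  0 <= riesz phi ((segm y g)^`()^`().[t%:MP] * q ^+ 2).
Proof.
move=> [r [L /hess_entries hess]] qe gen.
have Ls := msize_sos_factor hess.
rewrite (@deriv2_segm _ _ _ 1 (fun=> r) (fun=> 1) (fun=> L)); last first.
  by move=> i k; rewrite big_ord1 mul1r.
rewrite big_ord1 rmorph1 hornerC mul1r mulr_suml raddf_sum sumr_ge0 // => l _.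
rewrite -exprMn; apply: phi_sqr.
(* Entries of [L] have size at most [halfdeg g] and $x - y$ adds one, so the product with [q] has
   degree at most [halfdeg g + e]. *)
apply: leq_trans (_ : (halfdeg g).+1 + e <= _)%N; last by lia.
apply: leq_msizeM => //; exact: msize_segm_dir.
Qed.

Lemma sos_concave_Jensen g :
  sos_concave g -> (halfdeg g <= n)%N -> riesz phi g <= g.@[y].
Proof.
move=> gc gn.
rewrite -lerN2 -mevalN -raddfN; apply: riesz_tangent => t _.
rewrite -[X in riesz _ X]mulr1 -(expr1n _ 2).
by apply: (@riesz_sos_convex _ _ 0) => //; rewrite ?msize1 // halfdegN addn0.
Qed.

(** The chord inequality for [- g], whose weighted polynomial along the segment is convex since its
    second derivative is $\phi$ of a sum of squares. *)
Lemma sos_concave_segm g q (e : nat) t :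
  sos_concave g -> (msize q <= e.+1)%N -> (halfdeg g + e <= n)%N ->
  0 < t < 1 ->
  t * riesz phi (g * q ^+ 2) + (1 - t) * (g.@[y] * riesz phi (q ^+ 2)) <=
  riesz phi ((segm y g).[t%:MP] * q ^+ 2).
Proof.
move=> gc qe gen t01.
have := @convex_poly_chord R (segm_riesz phi y (q ^+ 2) (- g)) t.
rewrite segm_riesz0 segm_riesz1 horner_map_scalar /= /wriesz.
rewrite rmorphN hornerN !mulNr !raddfN /=. rewrite !(mulrN, mulNr) -opprD lerN2.
apply => // s s01; rewrite deriv2_segm_riesz.
by apply: (riesz_sos_convex _ gc qe); rewrite halfdegN.
Qed.

End Jensen.

(** * Exactness of the relaxation *)

Section Exactness.
Context {R : realType} {d m n : nat}.
Variables (g : 'I_m.+2 -> {mpoly R[d]}) (phi : momseq R d n).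
Hypotheses (g_first : g ord0 = 1)
  (g_concave : forall j, j != ord0 -> sos_concave (g j))
  (gn : forall j, (halfdeg (g j) <= n)%N)
  (phi_feas : feasible g phi).

Lemma feasible_sqr q : (msize q <= n.+1)%N -> 0 <= riesz phi (q ^+ 2).
Proof.
move=> qn; have [_ /(_ ord0 q)] := (feasibleP g phi).1 phi_feas.
by rewrite g_first mul1r /halfdeg /mpdeg msize1 subn0; apply.
Qed.

Lemma feasible_first_moments : Omega g (first_moments phi).
Proof.
move=> j j0; have [phi1 gpos] := (feasibleP g phi).1 phi_feas.
have := sos_concave_Jensen phi1 feasible_sqr (g_concave j0) (gn j).
apply: le_trans; rewrite -[g j]mulr1 -(expr1n _ 2) gpos // msize1; lia.
Qed.

Lemma Qmodule_convex_Jensen f r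
    (L : forall j : 'I_m.+2, 'M[{mpoly R[d]}]_(d, r j)) :
  hessian_Qmodule_cert f g L ->
  (1 + maxn (\max_(j < m.+2 | j != ord0) (mxdeg (L j) + halfdeg (g j)))
            (mxdeg (L ord0)) <= n)%N ->
  f.@[first_moments phi] <= riesz phi f.
Proof.
move=> /Qmodule_cert_entries hess Ln.
have [phi1 gpos] := (feasibleP g phi).1 phi_feas.
(* As $d_0 = 0$, both parts of the bound on $n$ take the single form $a_j + d_j < n$. *)
have Ldeg j : (mxdeg (L j) + halfdeg (g j) < n)%N.
  have [->|j0] := eqVneq j ord0.
    by rewrite g_first /halfdeg /mpdeg msize1 addn0; apply: leq_trans Ln; lia.
  apply: leq_trans Ln; rewrite ltnS leq_max.
  apply/orP; left.
  exact: (leq_bigmax_cond (F := fun j => (mxdeg (L j) + halfdeg (g j))%N)).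
apply: riesz_tangent => // t /andP[t0 t1].
rewrite (deriv2_segm _ _ hess) raddf_sum sumr_ge0 // => j _.
rewrite mulr_sumr raddf_sum sumr_ge0 // => l _.
have Ljs i : (msize (L j i l) <= (mxdeg (L j)).+1)%N.
  apply: leq_trans (leqSpred _) _; rewrite ltnS.
  apply: leq_trans (leq_bigmax i).
  exact: (leq_bigmax (F := fun l => mpdeg (L j i l)) l).
have := msize_segm_dir (first_moments phi) t Ljs.
set q : {mpoly R[d]} := horner (\sum_i _) _ => qs.
have q2 : 0 <= riesz phi (q ^+ 2).
  apply: feasible_sqr; apply: leq_trans qs _; have := Ldeg j; lia.
(* For $j = 0$ the factor $g_0 = 1$ is constant along the segment and the term is $\phi(q^2)$. *)
have [j0|j0] := eqVneq j ord0.
  by rewrite j0 g_first rmorph1 hornerC mul1r.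
have ge : (halfdeg (g j) + (mxdeg (L j)).+1 <= n)%N by have := Ldeg j; lia.
have t01 : 0 < t < 1 by rewrite t0.
(* Both ends of the chord are nonnegative: $\phi(g_j q^2)$ by the localizing matrix, $g_j(y)
   \phi(q^2)$ because $y$ lies in [Omega g]. *)
apply: le_trans (sos_concave_segm feasible_sqr (g_concave j0) qs ge t01).
rewrite addr_ge0 // mulr_ge0 ?subr_ge0 ?(ltW t0) ?(ltW t1) //.
  by apply: gpos; apply: leq_trans qs _; lia.
by rewrite mulr_ge0 // feasible_first_moments.
Qed.

End Exactness.

(** * Compactness of the feasible set *)

(** The divisor is built up one variable at a time. *)
Lemma split_multinom (d k : nat) (c : 'X_{1..d}) : (k <= mdeg c)%N ->
  exists2 a : 'X_{1..d}, mdeg a = k & (a <= c)%MM.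
Proof.
elim: k => [|k IHk] kc.
  by exists 0%MM; rewrite ?mdeg0 //; apply/mnm_lepP => i; rewrite mnm0E.
have [a ak ac] := IHk (ltnW kc).
have ca : (c - a)%MM != 0%MM.
  apply: contraTneq kc => ca0; rewrite -(submK ac) ca0 add0m ak; lia.
have [i ci] := mnm_neq0 ca.
exists (a + U_(i))%MM; first by rewrite mdegD mdeg1 ak addn1.
apply/mnm_lepP => j; rewrite mnmDE mnm1E.
have := mnm_lepP ac j; move: ci; rewrite mnmBE.
by have [->|] := eqVneq i j; lia.
Qed.

Section Bounded.
Context {R : realType} {d m n : nat}.
Variables (g : 'I_m.+2 -> {mpoly R[d]}) (phi : momseq R d n).
Hypotheses (g_first : g ord0 = 1)
  (g_last : g ord_max = 1 - \sum_(i < d) 'X_i ^+ 2)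
  (phi_feas : feasible g phi).

(** Only an inequality, since for $d = 0$ the polynomial is the constant 1. *)
Lemma halfdeg_last : (halfdeg (g ord_max) <= 1)%N.
Proof.
rewrite /halfdeg leq_uphalf_double /mpdeg -subn1 leq_subLR g_last.
rewrite (leq_trans (msizeD_le _ _)) // geq_max msize1 msizeN /=.
by apply: leq_msize_sum => i _; rewrite mpolyXn msizeX mdegMn mdeg1.
Qed.

(** Induction on the degree. For $a = e_i + b$, positivity of $\phi(g_{m+1} x^{2b})$ gives $\sum_j
    \phi(x_j^2 x^{2b}) \le \phi(x^{2b}) \le 1$, and every term of the sum is nonnegative. *)
Lemma even_moment_le1 (a : 'X_{1..d}) :
  (mdeg a <= n)%N -> riesz phi ('X_[a] ^+ 2) <= 1.
Proof.
have [phi1 gpos] := (feasibleP g phi).1 phi_feas.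
elim: {a}(mdeg a) {-2}a (erefl (mdeg a)) => [|k IHk] a ak an.
  by move/eqP: ak; rewrite mdeg_eq0 => /eqP ->; rewrite mpolyX0 expr1n phi1.
have [b bk ba] : exists2 b : 'X_{1..d}, mdeg b = k & (b <= a)%MM.
  by apply: split_multinom; rewrite ak.
have /eqP/mdeg1P[i /eqP ai] : mdeg (a - b)%MM = 1%N.
  by have := congr1 mdeg (submK ba); rewrite mdegD ak bk; lia.
have aE : a = (U_(i) + b)%MM by rewrite -ai submK.
have bn : (mdeg b <= n)%N by lia.
apply: le_trans (IHk b bk bn).
have Xb : (msize ('X_[b] : {mpoly R[d]}) <= (n - halfdeg (g ord_max)).+1)%N.
  by rewrite msizeX; have := halfdeg_last; lia.
have := gpos ord_max _ Xb; rewrite g_last mulrBl mul1r raddfB /= subr_ge0.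
rewrite mulr_suml raddf_sum (bigD1 i) //=; apply: le_trans.
rewrite aE mpolyXD exprMn lerDl sumr_ge0 // => j _.
by rewrite -exprMn -mpolyXD (feasible_sqr g_first) // msizeX mdegD mdeg1; lia.
Qed.

(** Split $a = b + c$ with both degrees at most $n$; then $\phi((x^c \pm x^b)^2) \ge 0$ bounds
    $|\phi(x^a)|$ by the mean of two even moments. *)
Lemma feasible_bound a : -1 <= phi a <= 1.
Proof.
have [phi1 gpos] := (feasibleP g phi).1 phi_feas.
have an : (mdeg a < n.*2.+1)%N := valP a.
have [b bn ba] : exists2 b : 'X_{1..d}, mdeg b = minn n (mdeg a) & (b <= a)%MM.
  by apply: split_multinom; rewrite geq_minr.
pose c := (a - b)%MM; have acb : (c + b)%MM = a := submK ba.
have cn : (mdeg c <= n)%N by have := congr1 mdeg acb; rewrite mdegD; lia.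
have bn' : (mdeg b <= n)%N by rewrite bn geq_minl.
have Xb := even_moment_le1 bn'; have Xc := even_moment_le1 cn.
have XX : riesz phi ('X_[c] * 'X_[b]) = phi a.
  by rewrite -mpolyXD acb riesz_mono.
have hD : (msize ('X_[c] + 'X_[b] : {mpoly R[d]}) <= n.+1)%N.
  by rewrite (leq_trans (msizeD_le _ _)) // geq_max !msizeX !ltnS cn.
have hB : (msize ('X_[c] - 'X_[b] : {mpoly R[d]}) <= n.+1)%N.
  by rewrite (leq_trans (msizeD_le _ _)) // geq_max msizeN !msizeX !ltnS cn.
have := feasible_sqr g_first phi_feas hD.
have := feasible_sqr g_first phi_feas hB.
rewrite sqrrB sqrrD !mulr2n !raddfD /= !raddfN /= XX; lra.
Qed.

End Bounded.

(** * Existence of optimal solutions *)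

Import numFieldNormedType.Exports.

Section Existence.
Context {R : realType} {d n : nat}.
Let N := #|{: 'X_{1..d < n.*2.+1}}|.

(** Row vectors give moment sequences the topology of a finite-dimensional space. *)
Definition momseq_of_row (v : 'rV[R]_N) : momseq R d n :=
  fun a => v 0 (enum_rank a).

Lemma momseq_of_rowK (phi : momseq R d n) :
  momseq_of_row (\row_i phi (enum_val i)) = phi.
Proof. by apply/boolp.funext => a; rewrite /momseq_of_row mxE enum_rankK. Qed.

Lemma riesz_continuous p :
  continuous (fun v : 'rV[R]_N => riesz (momseq_of_row v) p).
Proof.
apply: continuous_big => [|a _]; first exact: add_continuous.
move=> v; apply: (@continuous_comp _ _ _
  (fun v : 'rV[R]_N => v 0 (enum_rank a)) ( *%R p@_a)).
  exact: coord_continuous.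
exact: mulrl_continuous.
Qed.

Lemma optimal_exists m (f : {mpoly R[d]}) (g : 'I_m.+2 -> {mpoly R[d]})
    (phi0 : momseq R d n) :
  g ord0 = 1 -> g ord_max = 1 - \sum_(i < d) 'X_i ^+ 2 -> feasible g phi0 ->
  exists phi : momseq R d n, optimal f g phi.
Proof.
move=> g_first g_last feas0.
pose A := [set v | feasible g (momseq_of_row v)].
have A0 : A !=set0.
  by exists (\row_i phi0 (enum_val i)); rewrite /A /= momseq_of_rowK.
(* Tested on squares, feasibility is one linear equation and a family of weak linear inequalities,
   all closed conditions. *)
have Acl : closed A.
  have -> : A = [set v | riesz (momseq_of_row v) 1 = 1] `&`
      \bigcap_(jq in [set jq : 'I_m.+2 * {mpoly R[d]} |
                  (msize jq.2 <= (n - halfdeg (g jq.1)).+1)%N])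
        [set v | 0 <= riesz (momseq_of_row v) (g jq.1 * jq.2 ^+ 2)].
    apply/seteqP; split=> v.
      by move=> /feasibleP[v1 vg]; split=> // -[j q] /=; exact: vg.
    move=> [v1 vg]; apply/feasibleP; split=> // j q qn.
    exact: (vg (j, q)).
  apply: closedI.
    exact: ((continuous_closedP _).1 (@riesz_continuous 1) _ (@closed_eq R 1)).
  apply: closed_bigI => jq _.
  exact: ((continuous_closedP _).1 (@riesz_continuous _) _ (@closed_ge R 0)).
have Ac : compact A.
  (* The bound on the moments places [A] in the cube $[-1, 1]^N$. *)
  have box := @rV_compact R N (fun=> `[(-1 : R), 1])
    (fun=> @segment_compact R (-1) 1).
  apply: (subclosed_compact Acl box) => v Av i.
  have := feasible_bound g_first g_last Av (enum_val i).
  by rewrite /momseq_of_row enum_valK /= in_itv.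
have [v /set_mem Av vmin] := derive.EVT_min_rV A0 Ac
  (continuous_subspaceT (@riesz_continuous f)).
exists (momseq_of_row v); split=> // psi psi_feas.
rewrite -[psi]momseq_of_rowK; apply: vmin; apply/mem_set.
by rewrite /A /= momseq_of_rowK.
Qed.

End Existence.

(** * Attained infima and the final result *)

Lemma inf_min (R : realType) (E : set R) x : E x -> lbound E x -> inf E = x.
Proof.
move=> Ex Ex_lb; apply/le_anti/andP; split.
  by apply: ge_inf => //; exists x.
by apply: lb_le_inf => //; exists x.
Qed.

Theorem theorem3p4 (R : realType) (d m : nat)
    (g : 'I_m.+2 -> {mpoly R[d]}) (f : {mpoly R[d]})
    (r : 'I_m.+2 -> nat)
    (L : forall j : 'I_m.+2, 'M[{mpoly R[d]}]_(d, r j))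
    (g_first : g ord0 = 1)
    (g_last : g ord_max = 1 - \sum_(i < d) 'X_i ^+ 2)
    (Omega_neq0 : Omega g !=set0)
    (g_concave : forall j : 'I_m.+2, j != ord0 -> sos_concave (g j))
    (f_Qconvex : hessian_Qmodule_cert f g L) :
  (forall n : nat, (n_min f g <= n)%N ->
     exists phi : momseq R d n, optimal f g phi)
  /\
  (forall n : nat, (n_min f g <= n)%N ->
     (1 + maxn (\max_(j < m.+2 | j != ord0) (mxdeg (L j) + halfdeg (g j)))
               (mxdeg (L ord0)) <= n)%N ->
     forall phi : momseq R d n, optimal f g phi ->
       [/\ first_moments phi \in Omega g,
           rho f g n = fstar f g,
           fstar f g = f.@[first_moments phi]
         & forall x : 'I_d -> R, x \in Omega g ->
             f.@[first_moments phi] <= f.@[x]]).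
Proof.
have gn n : (n_min f g <= n)%N -> forall j, (halfdeg (g j) <= n)%N.
  by rewrite geq_max => /andP[/bigmax_leqP gn _] j; exact: gn.
split=> n fgn.
  have [x xO] := Omega_neq0.
  apply: (optimal_exists f g_first g_last (phi0 := moments_at x)).
  exact: (feasible_moments_at g_first (gn n fgn) xO).
move=> Ln phi [phi_feas phi_min].
have yO := feasible_first_moments g_first g_concave (gn n fgn) phi_feas.
have Jensen := Qmodule_convex_Jensen g_first g_concave (gn n fgn) phi_feas
  f_Qconvex Ln.
have phi_le x : Omega g x -> riesz phi f <= f.@[x].
  move=> xO; rewrite -(riesz_moments_at (n := n)).
    by apply: phi_min; apply: feasible_moments_at => //; exact: gn.
  apply: leq_trans (msize_halfdeg f) _; rewrite ltnS leq_double.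
  by move: fgn; rewrite geq_max => /andP[].
(* The Jensen inequality gives one side; the other is [phi_le] at the first moments, which lie in
   [Omega g]. *)
have phiE : riesz phi f = f.@[first_moments phi].
  by apply/le_anti/andP; split=> //; exact: phi_le.
have fstarE : fstar f g = f.@[first_moments phi].
  apply: inf_min; first by exists (first_moments phi).
  by move=> _ [x xO <-]; rewrite -phiE; exact: phi_le.
split=> //; first exact: mem_set.
  rewrite fstarE -phiE; apply: inf_min; first by exists phi.
  by move=> _ [psi psi_feas <-]; exact: phi_min.
by move=> x /set_mem xO; rewrite -phiE; exact: phi_le.
Qed.
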